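(* Let $\Gamma$ be a graph of order $n$ with node set $\{1,\dots,n\}$. The function $c_\Gamma(t)$ is a quasipolynomial whose period divides $\lambda(n_1)$, where $n_1$ is the largest order of a component of $\Gamma$. Furthermore, $(-1)^{n-1}c_\Gamma(0)$ is the number of acyclic orientations of $\Gamma$. More generally, $(-1)^{n-1} c_\Gamma(-t)$, for integers $t\geq0$, is the number of pairs consisting of an arbitrary weak composition $x=(x_1,\ldots,x_n)$ of $t$ into $n$ parts and, for each level set $x^{-1}(k)$, $0\leq k \leq t$, an acyclic orientation of the subgraph of $\Gamma$ induced by $x^{-1}(k)$.
   Context: Graphs are finite; the order of a graph is its number of nodes. A composition of a positive integer $t$ into $n$ parts is a representation of $t$ as an ordered sum $x_1+\cdots+x_n$ of positive integers; in a weak composition parts equal to $0$ are allowed as well. A composition is $\Gamma$-strict if $x_i\ne x_j$ whenever $ij$ is an edge of $\Gamma$. For positive integers $t$, $c_\Gamma(t)$ is the number of $\Gamma$-strict compositions of $t$ into $n$ parts. For a weak composition $x$, viewed as a function on the nodes, $x^{-1}(k)=\{i: x_i=k\}$. An orientation is acyclic if it has no directed cycles (the empty graph has exactly one acyclic orientation). $\lambda(k)=\operatorname{lcm}(1,2,\ldots,k)$. A quasipolynomial is a function $\sum_i c_i(t)t^i$ whose coefficients are periodic functions of the integer $t$; it is extended to all integers $t$, and $c_\Gamma(0)$, $c_\Gamma(-t)$ refer to this extension. *)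

(* Defs.v *)
From mathcomp Require Import all_boot all_order all_algebra.

Set Implicit Arguments.
Unset Strict Implicit.
Unset Printing Implicit Defensive.

Import GRing.Theory Num.Theory.

Section Graphs.

(* A simple graph is a symmetric irreflexive relation e. *)
Variables (T : finType) (e : rel T).

Definition components : {set {set T}} :=
  equivalence_partition (connect e) [set: T].

Definition max_component_order : nat := \max_(C in components) #|C|.

(* Same edges as the subgraph induced by S; the nodes outside S are kept but
   isolated, so that orientations of all induced subgraphs share one type. *)
Definition induced (S : {set T}) : rel T :=
  [rel i j | [&& i \in S, j \in S & e i j]].

(* An orientation is given by its set of arcs: (i, j) is the edge ij directed
   from i to j, and each edge gets exactly one of its two directions. *)
Definition is_orientation (A : {set T * T}) : bool :=
  [forall i, forall j,
     if e i j then ((i, j) \in A) (+) ((j, i) \in A) else (i, j) \notin A].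

Definition arc (A : {set T * T}) : rel T := [rel i j | (i, j) \in A].

(* A directed cycle has distinct nodes, hence length at most #|T|. *)
Definition acyclic (A : {set T * T}) : bool :=
  [forall k : 'I_#|T|, forall c : (k.+1).-tuple T, ~~ ucycleb (arc A) c].

Definition acyclic_orientations : {set {set T * T}} :=
  [set A | is_orientation A && acyclic A].

End Graphs.

Lemma acyclicP (T : finType) (A : {set T * T}) :
  reflect (forall c : seq T, ucycle (arc A) c -> c = [::]) (acyclic A).
Proof.
apply: (iffP forallP) => [acA c cyc | acA k]; last first.
  by apply/forallP => c; apply/negP => /acA; case: c => -[].
case: (posnP (size c)) => [/size0nil // | c_gt0].
have ltcT : (size c).-1 < #|T|.
  by rewrite prednK // -(card_uniqP (proj2 (andP cyc))) max_card.
have sz : size c == (Ordinal ltcT).+1 by rewrite /= prednK.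
by have /forallP/(_ (Tuple sz))/negP[] := acA (Ordinal ltcT).
Qed.

(* The parts of a (weak) composition of t are at most t, hence the codomain. *)
Definition weak_compositions (n t : nat) : {set {ffun 'I_n -> 'I_t.+1}} :=
  [set x : {ffun 'I_n -> 'I_t.+1} | (\sum_i x i)%N == t].

Definition compositions (n t : nat) : {set {ffun 'I_n -> 'I_t.+1}} :=
  [set x : {ffun 'I_n -> 'I_t.+1} in weak_compositions n t | [forall i, 0 < x i]].

Definition strict n (e : rel 'I_n) t (x : {ffun 'I_n -> 'I_t.+1}) : bool :=
  [forall i, forall j, e i j ==> (x i != x j)].

Definition strict_count n (e : rel 'I_n) (t : nat) : nat :=
  #|[set x : {ffun 'I_n -> 'I_t.+1} in compositions n t | strict e x]|.

Definition level n t (x : {ffun 'I_n -> 'I_t.+1}) (k : 'I_t.+1) : {set 'I_n} :=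
  [set i | x i == k].

Definition composition_orientation_pairs n (e : rel 'I_n) (t : nat) :
    {set {ffun 'I_n -> 'I_t.+1} * {ffun 'I_t.+1 -> {set 'I_n * 'I_n}}} :=
  [set p : {ffun 'I_n -> 'I_t.+1} * {ffun 'I_t.+1 -> {set 'I_n * 'I_n}} |
     (p.1 \in weak_compositions n t) &&
     [forall k, p.2 k \in acyclic_orientations (induced e (level p.1 k))]].

Definition lambda (k : nat) : nat := \big[lcmn/1%N]_(1 <= i < k.+1) i.

Local Open Scope ring_scope.

Definition has_period (p : nat) (f : int -> rat) : Prop :=
  exists (d : nat) (c : 'I_d -> int -> rat),
    (forall i t, c i (t + p%:Z) = c i t) /\
    (forall t, f t = \sum_(i < d) c i t * t%:~R ^+ i).

Definition quasipolynomial (f : int -> rat) : Prop :=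
  exists2 p : nat, (0 < p)%N & has_period p f.

Definition is_least_period (p : nat) (f : int -> rat) : Prop :=
  [/\ (0 < p)%N, has_period p f &
      forall q : nat, (0 < q)%N -> has_period q f -> (p <= q)%N].

Definition quasipolynomial_extension (c : nat -> nat) (f : int -> rat) : Prop :=
  quasipolynomial f /\ forall t : nat, (0 < t)%N -> f t%:Z = (c t)%:R.

(* Main.v *)
Require Import Defs.
From mathcomp Require Import all_boot all_order all_algebra.
From mathcomp Require Import zify ring lra.

(** Reciprocity follows by deletion and contraction, as for the chromatic
polynomial. Deleting an edge uv from a graph drops the condition that the parts
at u and v differ, so the strict compositions of the graph are those of the
deletion minus those with equal parts at u and v, which are the strict
compositions of the contraction. The nodes are never removed in a contraction:
the contracted edges are recorded as the fibers of an idempotent map r sending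
each node to a representative, and compositions are required to be constant on
these fibers. What is counted on the other side, acyclic orientations of level
sets, satisfies the recursion with the opposite sign: for each weak composition
x the edge uv matters only if x takes the same value at u and v, and given an
acyclic orientation of the other edges, at least one direction of uv creates no
cycle, while both are possible exactly if the orientation stays acyclic after
the contraction of uv ([acyclic_mod_deletion_contraction]). A contraction lowers
the number of fibers by one, which accounts for the sign.

When no edge is left, a composition constant on fibers is a solution of
sum_j w_j y_j = t where the w_j are the sizes of the fibers. The number of
positive solutions is a quasipolynomial whose value at - t is, up to the sign
(-1)^(k-1) for k unknowns, the number of nonnegative solutions. This is proved by
induction on k ([denumerant_ext_quasipoly]): the function that is defined on all
integers by these two counts satisfies f (s + a) - f s = g s, where a is the
first weight and g the function for the other weights, and summation preserves
quasipolynomials of period L as soon as a divides L ([quasipoly_sum]). Each fiber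
is connected in the graph, so its size is at most the largest order of a
component, and L can be the lcm of the integers up to that order
([strict_count_reciprocity]).

The coefficients of a quasipolynomial are determined by its values at positive
integers ([quasipoly_coefs_uniq]). Hence the extension is unique, and the periods
of a quasipolynomial are closed under gcd, so the least period divides L. *)

Set Implicit Arguments.
Unset Strict Implicit.
Unset Printing Implicit Defensive.

Import Order.TTheory GRing.Theory Num.Theory.

(** * Quasipolynomials *)

Local Open Scope ring_scope.

(** The coefficients c_0(t), c_1(t), ... are kept together as one polynomial
[C t], so that operations on quasipolynomials become operations on polynomials. *)
Definition quasipoly_coefs (p : nat) (f : int -> rat) (C : int -> {poly rat}) :=
  (forall t, C (t + p%:Z) = C t) /\ (forall t, f t = (C t).[t%:~R]).

Definition quasipoly (p : nat) (f : int -> rat) := exists C, quasipoly_coefs p f C.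

Lemma periodic_mulz (U : Type) (C : int -> U) (p : nat) :
  (forall t, C (t + p%:Z) = C t) -> forall (k t : int), C (t + k * p%:Z) = C t.
Proof.
move=> Cp.
have Cn (k : nat) t : C (t + k%:Z * p%:Z) = C t.
  elim: k => [|k IHk]; first by rewrite mul0r addr0.
  by rewrite -addn1 PoszD mulrDl mul1r addrA Cp.
move=> [] k t //; rewrite NegzE -(Cn k.+1).
by congr C; rewrite mulNr subrK.
Qed.

Lemma has_periodP p f : (0 < p)%N -> has_period p f <-> quasipoly p f.
Proof.
move=> p_gt0; split=> [[d [c [cp cE]]] | [C [Cp CE]]].
  exists (fun t => \sum_(i < d) c i t *: 'X^i); split=> t.
    by apply: eq_bigr => i _; rewrite cp.
  rewrite cE horner_sum; apply: eq_bigr => i _.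
  by rewrite hornerZ hornerXn.
exists (\max_(r < p) size (C r%:Z))%N, (fun i t => (C t)`_i); split=> [i t | t].
  by rewrite Cp.
rewrite CE; apply: horner_coef_wide.
have p0 : p%:Z != 0 by case: p p_gt0 {Cp}.
have tE : t = (t %% p%:Z)%Z + (t %/ p%:Z)%Z * p%:Z by rewrite addrC -divz_eq.
have lt_r : (`|(t %% p%:Z)%Z| < p)%N.
  by rewrite -ltz_nat gez0_abs ?modz_ge0 // ltz_mod.
rewrite tE periodic_mulz // -{1}(gez0_abs (modz_ge0 t p0)).
exact: (leq_bigmax (Ordinal lt_r)).
Qed.

(** On each residue class modulo a common period, the difference of the two
coefficient polynomials is one fixed polynomial, and it vanishes at infinitely
many positive integers. *)
Lemma quasipoly_coefs_uniq (q : nat) (C D : int -> {poly rat}) : (0 < q)%N ->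
    (forall t, C (t + q%:Z) = C t) -> (forall t, D (t + q%:Z) = D t) ->
    (forall t : int, 0 < t -> (C t).[t%:~R] = (D t).[t%:~R]) ->
  forall t, C t = D t.
Proof.
move=> q0 Cq Dq CD t; apply/eqP; rewrite -subr_eq0; apply/eqP.
set P := C t - D t.
pose a k := t + (`|t|.+1 + k)%N%:Z * q%:Z.
have a0 k : 0 < a k by rewrite /a; nia.
have rootP k : root P (a k)%:~R.
  rewrite /root !hornerE subr_eq0; apply/eqP.
  have := CD _ (a0 k).
  by rewrite {1 3}/a (periodic_mulz Cq) (periodic_mulz Dq).
apply/eqP/negPn/negP => P0.
have := @max_poly_roots _ P [seq (a k)%:~R | k <- iota 0 (size P)] P0.
rewrite size_map size_iota ltnn.
have -> : all (root P) [seq (a k)%:~R | k <- iota 0 (size P)].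
  by apply/allP => x /mapP[k _ ->].
rewrite map_inj_uniq ?iota_uniq => [/(_ isT isT) // | i j /intr_inj].
by move/addrI; nia.
Qed.

Lemma quasipoly_uniq p q f g :
    (0 < p)%N -> (0 < q)%N -> quasipoly p f -> quasipoly q g ->
    (forall t : nat, (0 < t)%N -> f t%:Z = g t%:Z) -> forall t, f t = g t.
Proof.
move=> p0 q0 [C [Cp fE]] [D [Dq gE]] fg t; rewrite fE gE.
rewrite (@quasipoly_coefs_uniq (p * q) C D) ?muln_gt0 ?p0 //.
- by move=> s; rewrite PoszM mulrC periodic_mulz.
- by move=> s; rewrite PoszM periodic_mulz.
by move=> [s|//] s0; rewrite -fE -gE fg.
Qed.

(** By uniqueness of the coefficients C, the number p is a period of f exactly if
C is p-periodic. As C is L-periodic, this can be tested on the residues modulo L,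
so that a least period exists; and Bezout makes gcd(p, L) a period. *)
Lemma least_period_dvd (L : nat) f : (0 < L)%N -> quasipoly L f ->
  exists2 p : nat, is_least_period p f & (p %| L)%N.
Proof.
move=> L0 [C [CL fE]].
pose P p := (0 < p)%N && [forall r : 'I_L, C (r%:Z + p%:Z) == C r].
have PP p : reflect ((0 < p)%N /\ forall t, C (t + p%:Z) = C t) (P p).
  apply: (iffP andP) => -[p0 Cp]; split=> //; last first.
    by apply/forallP => r; apply/eqP.
  move=> t; have Lz : L%:Z != 0 by case: L L0 {CL Cp P}.
  rewrite (divz_eq t L%:Z) [_ * _ + _]addrC addrAC !(periodic_mulz CL).
  have lt_r : (`|(t %% L%:Z)%Z| < L)%N.
    by rewrite -ltz_nat gez0_abs ?modz_ge0 // ltz_mod.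
  have := eqP (forallP Cp (Ordinal lt_r)).
  by rewrite /= !gez0_abs ?modz_ge0.
have PL : P L by apply/PP.
have hpP p : (0 < p)%N -> has_period p f -> P p.
  move=> p0 /(has_periodP _ p0) [D [Dp fD]]; apply/PP; split=> // t.
  suff CD s : C s = D s by rewrite !CD.
  apply: (@quasipoly_coefs_uniq (p * L)); rewrite ?muln_gt0 ?p0 //.
  - by move=> u; rewrite PoszM periodic_mulz.
  - by move=> u; rewrite PoszM mulrC periodic_mulz.
  by move=> u _; rewrite -fE -fD.
case: (ex_minnP (ex_intro P L PL)) => p /PP[p0 Cp] p_min.
exists p; first split=> //.
- by apply/has_periodP => //; exists C.
- by move=> q q0 /(hpP _ q0)/p_min.
have : P (gcdn p L).
  apply/PP; split=> [|t]; first by rewrite gcdn_gt0 p0.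
  have [u [v uv]] := Bezoutz p%:Z L%:Z.
  have -> : (gcdn p L)%:Z = u * p%:Z + v * L%:Z by rewrite uv.
  by rewrite addrA !periodic_mulz.
move/p_min=> le_p; suff <- : gcdn p L = p by apply: dvdn_gcdr.
by apply/eqP; rewrite eqn_leq le_p dvdn_leq // dvdn_gcdl.
Qed.

Lemma quasipolyD p f g : quasipoly p f -> quasipoly p g ->
  quasipoly p (fun t => f t + g t).
Proof.
move=> [C [Cp fE]] [D [Dp gE]]; exists (fun t => C t + D t).
by split=> t; rewrite ?Cp ?Dp // hornerD fE gE.
Qed.

Lemma quasipolyZ p f (a : rat) : quasipoly p f -> quasipoly p (fun t => a * f t).
Proof.
move=> [C [Cp fE]]; exists (fun t => a *: C t).
by split=> t; rewrite ?Cp // hornerZ fE.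
Qed.

Lemma quasipoly_shift p f (b : int) : quasipoly p f -> quasipoly p (fun t => f (t + b)).
Proof.
move=> [C [Cp fE]]; exists (fun t => C (t + b) \Po ('X + b%:~R%:P)).
split=> t; first by rewrite addrAC Cp.
by rewrite horner_comp !hornerE fE intrD.
Qed.

Lemma quasipoly_ext p f g : f =1 g -> quasipoly p f -> quasipoly p g.
Proof. by move=> fg [C [Cp fE]]; exists C; split=> // t; rewrite -fg fE. Qed.

Lemma quasipoly_periodic (p : nat) (f : int -> rat) :
  (forall t, f (t + p%:Z) = f t) -> quasipoly p f.
Proof. by move=> fp; exists (fun t => (f t)%:P); split=> t; rewrite ?fp ?hornerC. Qed.

(** The image of the difference operator is closed under linear combinations and
contains each power of X by induction on the exponent d, since the difference of
X^(d+1) is (d+1) c X^d plus lower terms. *)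
Lemma antidifference (c : rat) (Q : {poly rat}) : c != 0 ->
  exists P : {poly rat}, P \Po ('X + c%:P) - P == Q.
Proof.
move=> c0; pose im (Q : {poly rat}) :=
  exists P : {poly rat}, P \Po ('X + c%:P) - P == Q.
have im0 : im 0 by exists 0; rewrite comp_poly0 subr0.
have imD P1 P2 : im P1 -> im P2 -> im (P1 + P2).
  move=> [R1 /eqP<-] [R2 /eqP<-]; exists (R1 + R2); apply/eqP.
  by rewrite comp_polyD opprD addrACA.
have imZ a P1 : im P1 -> im (a *: P1).
  by move=> [R1 /eqP<-]; exists (a *: R1); rewrite comp_polyZ scalerBr.
have imX d : im 'X^d.
  elim/ltn_ind: d => d IHd.
  (* The difference of X^(d+1), without its leading term. *)
  pose low : {poly rat} := \sum_(i < d) (c ^+ (d.+1 - i) *+ 'C(d.+1, i)) *: 'X^i.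
  have low_im : im low.
    by rewrite /low; elim/big_rec: _ => // i Q1 _; apply: imD; apply/imZ/IHd.
  have top : im ('X^(d.+1) \Po ('X + c%:P) - 'X^(d.+1)) by exists 'X^(d.+1).
  have E : ('X^d : {poly rat}) = (c *+ d.+1)^-1 *:
      ('X^(d.+1) \Po ('X + c%:P) - 'X^(d.+1) + (-1) *: low).
    rewrite comp_Xn_poly ['X + _]addrC exprDn !big_ord_recr /=.
    rewrite subnn subSnn binn binSn expr0 expr1 mulr1n mul1r addrK.
    rewrite [X in X + _ + _](_ : _ = low) => [|]; last first.
      apply: eq_bigr => i _; rewrite -polyC_exp -mul_polyC polyCMn.
      by rewrite mulrnAl.
    rewrite scaleN1r addrAC subrr add0r -mulrnAl -polyCMn mul_polyC.
    rewrite scalerA mulVf ?scale1r //.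
    by rewrite mulrn_eq0.
  by rewrite E; apply/imZ/imD => //; apply: imZ.
rewrite -/(im Q) -[Q]coefK poly_def.
by elim/big_rec: _ => // i Q1 _; apply: imD; apply: imZ.
Qed.

(** Summing the increments over a block of L / a steps reduces to the case a = L.
There an antidifference of the coefficient polynomials differs from f by an
L-periodic function, which is absorbed in the constant coefficient. *)
Lemma quasipoly_sum (L a : nat) (f : int -> rat) : (0 < L)%N -> (a %| L)%N ->
  quasipoly L (fun t => f (t + a%:Z) - f t) -> quasipoly L f.
Proof.
move=> L0 /dvdnP[m Lm] qa.
have qm k : quasipoly L (fun t => f (t + (k * a)%N%:Z) - f t).
  elim: k => [|k IHk].
    by apply: quasipoly_periodic => t; rewrite mul0n !addr0 !subrr.
  apply: quasipoly_ext (quasipolyD (quasipoly_shift (k * a)%N%:Z qa) IHk) => t.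
  by rewrite addrA subrK mulSn PoszD -addrA (addrC (Posz a)).
have [C [CL CE]] := qm m; rewrite -Lm in CE.
have L0' : (L%:R : rat) != 0 by rewrite pnatr_eq0 -lt0n.
pose D t := xchoose (antidifference (C t) L0').
have DE t : (D t).[t%:~R + L%:R] - (D t).[t%:~R] = (C t).[t%:~R].
  have /eqP <- := xchooseP (antidifference (C t) L0').
  by rewrite !hornerE horner_comp !hornerE.
have DL t : D (t + L%:Z) = D t by rewrite /D; apply: eq_xchoose => P /=; rewrite CL.
exists (fun t => D t + (f t - (D t).[t%:~R])%:P).
split=> t; last by rewrite hornerD hornerC addrC subrK.
rewrite DL; congr (_ + _%:P).
rewrite intrD -[X in _.[_ + X]]/(L%:R).
by have := CE t; have := DE t; lra.
Qed.

(** * Solutions of a linear equation with positive weights *)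

(** Counts the solutions of sum_j w_j y_j = t in integers y_j >= lo; the values 0
and 1 of lo are the two sides of reciprocity. *)
Fixpoint denumerant (lo : nat) (w : seq nat) (t : nat) : nat :=
  if w is a :: w' then
    (\sum_(lo <= y < t.+1 | a * y <= t) denumerant lo w' (t - a * y))%N
  else t == 0%N.

Lemma denumerant_widen lo a w t M : (0 < a)%N -> (t < M)%N ->
  denumerant lo (a :: w) t =
  (\sum_(lo <= y < M | a * y <= t) denumerant lo w (t - a * y))%N.
Proof.
move=> a0 tM /=; rewrite (big_nat_widen _ t.+1 M) //; apply: eq_bigl => y.
by case: leqP => //= le_ay; nia.
Qed.

Lemma denumerant0_small a w t : (t < a)%N ->
  denumerant 0 (a :: w) t = denumerant 0 w t.
Proof.
move=> ta; rewrite /= big_ltn_cond // muln0 leq0n subn0.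
rewrite big_nat_cond big_pred0 ?addn0 //.
by move=> y; apply/negbTE; nia.
Qed.

(** Either the first unknown vanishes, or it can be lowered by one. *)
Lemma denumerant0_add a w t : (0 < a)%N ->
  denumerant 0 (a :: w) (t + a) = (denumerant 0 (a :: w) t + denumerant 0 w (t + a))%N.
Proof.
move=> a0; rewrite (@denumerant_widen _ _ _ (t + a) (t + a).+1) //.
rewrite big_ltn_cond // muln0 leq0n subn0 addnC; congr (_ + _)%N.
rewrite (@denumerant_widen _ _ _ t (t + a)) ?big_add1 /=; [| lia | lia].
apply: eq_big => [y | y le_ay]; first by rewrite mulnS addnC leq_add2r.
by congr denumerant; rewrite mulnS; lia.
Qed.

(** Either the first unknown is 1, or it can be lowered by one. *)
Lemma denumerant1_add a w t : (0 < a)%N ->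
  denumerant 1 (a :: w) (t + a) = (denumerant 1 (a :: w) t + denumerant 1 w t)%N.
Proof.
move=> a0; rewrite (@denumerant_widen _ _ _ (t + a) (t + a).+2); [| lia | lia].
rewrite big_ltn_cond // muln1 leq_addl addnK addnC; congr (_ + _)%N.
rewrite (@denumerant_widen _ _ _ t (t + a).+1); [| lia | lia].
rewrite [LHS]big_add1 /=.
apply: eq_big => [y | y le_ay]; first by rewrite mulnS addnC leq_add2r.
by congr denumerant; rewrite mulnS; lia.
Qed.

Lemma denumerant1_lt w t : all (leq 1) w -> (t < sumn w)%N ->
  denumerant 1 w t = 0%N.
Proof.
elim: w t => //= a w IHw t /andP[a0 w0] tw.
rewrite big_nat_cond big1 // => y /andP[/andP[y1 _] le_ay].
by apply: IHw => //; nia.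
Qed.

Lemma denumerant_singleton lo a t : (0 < a)%N -> (lo <= 1)%N -> (lo <= t)%N ->
  denumerant lo [:: a] t = (a %| t)%N.
Proof.
move=> a0 lo1 lo_t.
have [/dvdnP[k tE] | ndvd] := boolP (a %| t)%N; last first.
  rewrite /= big1 // => y le_ay; apply/eqP; rewrite eqb0.
  apply: contra ndvd; rewrite subn_eq0 => le_ta.
  by apply/dvdnP; exists y; lia.
rewrite /= big_mkcond (bigD1_seq k) ?iota_uniq //=; last first.
  by rewrite mem_index_iota; nia.
rewrite tE mulnC leqnn subnn big1 // => y y_k.
by case: ifP => // le_ay; apply/eqP; rewrite eqb0; nia.
Qed.

(** The quasipolynomial that counts positive solutions, given by the values that
reciprocity predicts at the integers s <= 0. *)
Definition denumerant_ext (w : seq nat) (s : int) : rat :=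
  if s is Posz t.+1 then (denumerant 1 w t.+1)%:R
  else (-1) ^+ (size w).-1 * (denumerant 0 w `|s|)%:R.

Lemma denumerant_ext_pos w (t : nat) : (0 < t)%N ->
  denumerant_ext w t%:Z = (denumerant 1 w t)%:R.
Proof. by case: t. Qed.

Lemma denumerant_ext_npos w (t : nat) :
  denumerant_ext w (- t%:Z) = (-1) ^+ (size w).-1 * (denumerant 0 w t)%:R.
Proof. by case: t. Qed.

(** For s > 0 and for s <= - a this is the recursion of the positive and of the
nonnegative count. For - a < s <= 0 the two counts meet: there is no positive
solution for s + a, which is less than the sum of the weights, and a nonnegative
solution for - s has first unknown 0. *)
Lemma denumerant_ext_diff a w s : (0 < a)%N -> (0 < size w)%N -> all (leq 1) w ->
  denumerant_ext (a :: w) (s + a%:Z) - denumerant_ext (a :: w) s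
    = denumerant_ext w s.
Proof.
move=> a0 w_gt0 w1.
have [s_gt0 | s_le0] := ltP 0 s.
  have -> : s = `|s|%N%:Z by lia.
  rewrite -PoszD !denumerant_ext_pos ?denumerant1_add //; try lia.
  by rewrite natrD addrAC subrr add0r.
have sgn : (-1) ^+ (size (a :: w)).-1 = - (-1) ^+ (size w).-1 :> rat.
  by rewrite [LHS]/= -{1}(prednK w_gt0) exprS mulN1r.
have -> : s = - `|s|%N%:Z by lia.
set t := `|s|%N; rewrite !denumerant_ext_npos sgn.
have [ta | at_] := ltnP t a.
  have -> : - t%:Z + a%:Z = (a - t)%N%:Z by lia.
  rewrite denumerant_ext_pos ?subn_gt0 // denumerant0_small //.
  rewrite denumerant1_lt ?sub0r ?mulNr ?opprK //= ?a0 //.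
  case: w w_gt0 w1 {sgn} => //= b w _ /andP[b0 _]; lia.
have -> : - t%:Z + a%:Z = - (t - a)%N%:Z by lia.
rewrite denumerant_ext_npos sgn -{2}(subnK at_) denumerant0_add // subnK // natrD.
by ring.
Qed.

(** One weight a gives the indicator of the multiples of a on both sides, which
starts the induction: for zero weights the two counts would not fit together
at t = 0. *)
Lemma denumerant_ext_quasipoly (L : nat) w : (0 < L)%N -> (0 < size w)%N ->
  all (fun a => (0 < a)%N && (a %| L)%N) w -> quasipoly L (denumerant_ext w).
Proof.
move=> L0; elim: w => // a [|b w] IHw _ /= /andP[/andP[a0 aL] wL].
  apply: (@quasipoly_ext _ (fun s => ((a %| s)%Z : nat)%:R)) => [s|]; last first.
    apply: quasipoly_periodic => t; congr (_ _)%:R.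
    by rewrite rpredDr ?dvdzE.
  have [s_gt0 | s_le0] := ltP 0 s.
    have -> : s = `|s|%N%:Z by lia.
    by rewrite denumerant_ext_pos ?denumerant_singleton //; lia.
  have -> : s = - `|s|%N%:Z by lia.
  rewrite denumerant_ext_npos denumerant_singleton //= mul1r.
  by rewrite dvdzE abszN.
apply: (quasipoly_sum L0 aL); apply: quasipoly_ext (IHw isT wL) => s.
rewrite denumerant_ext_diff //.
by apply: (@sub_all _ (fun c => (0 < c)%N && (c %| L)%N) _ _ (b :: w)) wL => c /andP[].
Qed.

(** * Acyclic orientations modulo contracted edges *)

Local Close Scope ring_scope.

Section Acyclic.

Variable T : finType.
Implicit Types (A : {set T * T}) (r : T -> T) (u v : T).

Definition add_arc (R : rel T) u v : rel T :=
  fun a b => R a b || (a == u) && (b == v).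

Lemma connect_add_arc (R : rel T) u v a b :
  connect (add_arc R u v) a b = connect R a b || connect R a u && connect R v b.
Proof.
have subR : subrel (connect R) (connect (add_arc R u v)).
  by apply: connect_sub => c d Rcd; apply: connect1; rewrite /add_arc Rcd.
apply/idP/orP => [/connectP[p] | [/subR // | /andP[/subR au /subR vb]]].
  elim: p a => [|c p IHp] a /=; first by move=> _ ->; left; apply: connect0.
  case/andP=> ac cp bE; have := IHp c cp bE.
  case/orP: ac => [/connect1 Rac | /andP[/eqP-> /eqP->]].
    case=> [Rcb | /andP[Rcu Rvb]]; [left | right].
      exact: connect_trans Rcb.
    by rewrite (connect_trans Rac).
  by case=> [Rvb | /andP[_ Rvb]]; right; rewrite connect0.
apply: connect_trans au (connect_trans _ vb); apply: connect1.
by rewrite /S /add_arc !eqxx orbT.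
Qed.

(** The fibers of r are the nodes of the contracted graph: a walk may move freely
inside a fiber. *)
Definition step A r : rel T := fun a b => ((a, b) \in A) || (r a == r b).

(** No arc lies on a closed walk, that is, the contracted graph has no directed
cycle; an arc inside a fiber counts as a cycle. *)
Definition acyclic_mod r A : bool :=
  [forall p in A, ~~ connect (step A r) p.2 p.1].

Lemma acyclic_modP r A :
  reflect (forall a b, (a, b) \in A -> ~~ connect (step A r) b a) (acyclic_mod r A).
Proof.
apply: (iffP forall_inP) => [acA a b | acA [a b]]; last exact: acA.
exact: (acA (a, b)).
Qed.

Lemma step_addE A r u v : step ((u, v) |: A) r =2 add_arc (step A r) u v.
Proof.
by move=> a b; rewrite /add_arc /step !inE xpair_eqE -orbA orbC.
Qed.

Lemma acyclic_mod_add r A u v :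
  acyclic_mod r ((u, v) |: A) = acyclic_mod r A && ~~ connect (step A r) v u.
Proof.
apply/acyclic_modP/andP => [acA | [/acyclic_modP acA vu] a b].
  have acA' a b : (a, b) \in (u, v) |: A -> ~~ connect (step A r) b a.
    by move/acA; rewrite (eq_connect (step_addE A r u v)) connect_add_arc => /norP[].
  split; last by apply: acA'; rewrite !inE eqxx.
  by apply/acyclic_modP => a b abA; apply: acA'; rewrite !inE abA orbT.
rewrite (eq_connect (step_addE A r u v)) connect_add_arc.
rewrite !inE xpair_eqE => /orP[/andP[/eqP-> /eqP->] | abA]; first by rewrite andbb orbb.
rewrite (negPf (acA _ _ abA)) /=; apply: contra vu => /andP[bu va].
apply: connect_trans va (connect_trans _ bu).
by apply: connect1; rewrite /step abA.
Qed.

(** A walk from a to b that leaves its fiber uses an arc of A, and the way back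
from b would put this arc on a closed walk. *)
Lemma acyclic_mod_antisym r A a b : acyclic_mod r A ->
  connect (step A r) a b -> connect (step A r) b a -> r a = r b.
Proof.
move=> /acyclic_modP acA /connectP[p].
elim: p a => [|c p IHp] a /=; first by move=> _ ->.
case/andP=> ac cp bE ba.
have cb : connect (step A r) c b by apply/connectP; exists p.
case/orP: (ac) => [acIA | /eqP->].
  by case/negP: (acA _ _ acIA); apply: connect_trans cb ba.
apply: IHp cp bE _; apply: connect_trans ba (connect1 ac).
Qed.

(** If contracting the fibers of a coarser map m leaves A acyclic, two nodes that
are identified by m but not by r cannot be connected modulo r: the connection
would contain an arc of A, and identifying its ends would close a cycle. *)
Lemma acyclic_mod_coarser r m A a b :
    (forall c d, r c = r d -> m c = m d) -> acyclic_mod m A ->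
  connect (step A r) a b -> m a = m b -> r a = r b.
Proof.
move=> rm /acyclic_modP acA /connectP[p].
elim: p a => [|c p IHp] a /=; first by move=> _ ->.
case/andP=> ac cp bE mab; case/orP: ac => [acIA | /eqP rac]; last first.
  by rewrite rac; apply: IHp cp bE _; rewrite -(rm _ _ rac).
case/negP: (acA _ _ acIA).
have: connect (step A m) c b.
  apply: (@connect_sub _ (step A r)); last by apply/connectP; exists p.
  by move=> d f df; apply: connect1; case/orP: df => [df | /eqP/rm df];
    rewrite /step df ?eqxx ?orbT.
by move/connect_trans; apply; apply: connect1; rewrite /step mab eqxx orbT.
Qed.

(** Contraction of the edge uv: the fiber of v is given the representative of
the fiber of u. *)
Definition merge_fibers r u v : T -> T := fun i => if r i == r v then r u else r i.

(** Identifying u with v has the same effect on walks as two opposite arcs between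
them, which makes [connect_add_arc] available for contractions. *)
Lemma connect_step_merge A r u v a b :
  connect (step A (merge_fibers r u v)) a b
    = connect (add_arc (add_arc (step A r) u v) v u) a b.
Proof.
have ruv : merge_fibers r u v u = merge_fibers r u v v.
  by rewrite /merge_fibers eqxx; case: ifP.
apply/idP/idP; apply: connect_sub => {a b} a b; last first.
  rewrite /add_arc => /orP[/orP[ab | /andP[/eqP-> /eqP->]] | /andP[/eqP-> /eqP->]].
  - apply: connect1; rewrite /step; case/orP: ab => [-> // | /eqP rab].
    by apply/orP; right; rewrite /merge_fibers rab.
  - by apply: connect1; rewrite /step ruv eqxx orbT.
  by apply: connect1; rewrite /step ruv eqxx orbT.
set S := add_arc _ _ _.
have Sr c d : r c = r d -> connect S c d.
  by move=> rcd; apply: connect1; rewrite /S /add_arc /step rcd eqxx !orbT.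
have Suv : connect S u v by apply: connect1; rewrite /S /add_arc !eqxx !orbT.
have Svu : connect S v u by apply: connect1; rewrite /S /add_arc !eqxx !orbT.
case/orP=> [abA | ]; first by apply: connect1; rewrite /S /add_arc /step abA.
rewrite /merge_fibers; have [av | _] := eqVneq (r a) (r v);
  have [bv | _] := eqVneq (r b) (r v); move/eqP => rab.
- by apply: Sr; rewrite av bv.
- exact: connect_trans (Sr _ _ av) (connect_trans Svu (Sr _ _ rab)).
- exact: connect_trans (Sr _ _ rab) (connect_trans Suv (Sr _ _ (esym bv))).
exact: Sr.
Qed.

(** A closed walk through an arc (a, b) of A in the contraction uses the
identification of u with v; cutting it there gives a walk modulo r from u to v
or from v to u, or a closed walk through (a, b). *)
Lemma acyclic_mod_merge r A u v : r u != r v ->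
  acyclic_mod (merge_fibers r u v) A =
  [&& acyclic_mod r A, ~~ connect (step A r) u v & ~~ connect (step A r) v u].
Proof.
move=> ruv.
have E a b : connect (step A (merge_fibers r u v)) a b =
    [|| connect (step A r) a b, connect (step A r) a u && connect (step A r) v b |
       (connect (step A r) a v || connect (step A r) a u && connect (step A r) v v) &&
       (connect (step A r) u b || connect (step A r) u u && connect (step A r) v b)].
  by rewrite connect_step_merge !connect_add_arc orbA.
set C := connect (step A r) in E *.
have arcC a b : (a, b) \in A -> C a b by move=> abA; apply: connect1; rewrite /step abA.
have trC b a c : C a b -> C b c -> C a c by apply: connect_trans.
apply/acyclic_modP/and3P => [acA | [/acyclic_modP acA uv vu] a b abA].
  have acA' a b : (a, b) \in A -> ~~ C b a by move/acA; rewrite E => /norP[].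
  have acA'' : acyclic_mod r A by apply/acyclic_modP.
  have acm : acyclic_mod (merge_fibers r u v) A by apply/acyclic_modP.
  have rm a b : r a = r b -> merge_fibers r u v a = merge_fibers r u v b.
    by rewrite /merge_fibers => ->.
  have muv : merge_fibers r u v u = merge_fibers r u v v.
    by rewrite /merge_fibers eqxx; case: ifP.
  split=> //; apply: contra ruv => /(acyclic_mod_coarser rm acm) -> //.
have nCba : ~~ C b a := acA _ _ abA.
rewrite E (negPf nCba) /=.
have Cab := arcC _ _ abA.
have CC c : C c c by apply: connect0.
rewrite !CC andbT /=.
apply/norP; split.
  by apply: contra vu => /andP[bu va]; apply: trC va (trC _ _ _ Cab bu).
apply/negP => /andP[/orP[bv | bu] /orP[ua | va]].
- by case/negP: uv; apply: trC ua (trC _ _ _ Cab bv).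
- by case/negP: nCba; apply: trC bv va.
- by case/negP: nCba; apply: trC bu ua.
by case/negP: vu; apply: trC va (trC _ _ _ Cab bu).
Qed.

(** The arc uv is admissible unless v leads to u. If A is acyclic, u and v cannot
lead to each other, so at least one direction is admissible, and both are
exactly if A stays acyclic when u and v are identified. *)
Lemma acyclic_mod_deletion_contraction r A u v : r u != r v ->
  (acyclic_mod r ((u, v) |: A) + acyclic_mod r ((v, u) |: A)
    = acyclic_mod r A + acyclic_mod (merge_fibers r u v) A)%N.
Proof.
move=> ruv; rewrite !acyclic_mod_add acyclic_mod_merge //.
have [acA | //] := boolP (acyclic_mod r A) => /=.
have [uv | ] := boolP (connect (step A r) u v) => /=; last by rewrite addnC.
have [vu | //] := boolP (connect (step A r) v u) => /=.
by case/eqP: ruv; apply: acyclic_mod_antisym uv vu.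
Qed.

Lemma acyclic_mod_loop r A u v : r u = r v -> acyclic_mod r ((u, v) |: A) = false.
Proof.
move=> ruv; rewrite acyclic_mod_add connect1 ?andbF //.
by rewrite /step ruv eqxx orbT.
Qed.

(** An arc (a, b) on a closed walk, shortened to a path from b to a without
repetition, closes up to a directed cycle with distinct nodes. *)
Lemma acyclic_mod_id A : irreflexive (Defs.arc A) -> acyclic_mod id A = acyclic A.
Proof.
move=> irrA; have E a b : connect (step A id) a b = connect (Defs.arc A) a b.
  apply/idP/idP; apply: connect_sub => {a b} a b.
    by case/orP => [abA | /eqP->]; [apply: connect1 | apply: connect0].
  by move=> abA; apply: connect1; apply/orP; left.
apply/acyclic_modP/acyclicP => [acA [//|a c] /andP[cyc _] | acA a b abA].
  exfalso; move: cyc (last_rcons a c a) (size_rcons c a).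
  rewrite /cycle; case: (rcons c a) => [//|b q] /= => /andP[ab bq] aE _.
  by have := acA a b ab; rewrite E => /connectP[]; exists q.
rewrite E; apply/negP => /connectP[p bp aE].
move: bp aE; case/shortenP => q bq uq _ aE.
suff : b :: q = [::] by [].
by apply: acA; apply/andP; split=> //; rewrite /cycle rcons_path bq -aE.
Qed.

(** The list E contains each edge once, in an arbitrary direction. *)
Definition orientations (E : seq (T * T)) : seq {set T * T} :=
  foldr (fun p As => [seq p |: A | A <- As] ++ [seq (p.2, p.1) |: A | A <- As])
    [:: set0] E.

Definition acyclic_count r E := count (acyclic_mod r) (orientations E).

Lemma acyclic_count_nil r : acyclic_count r [::] = 1%N.
Proof.
rewrite /acyclic_count /= addn0; apply/eqP; rewrite eqb1.
by apply/acyclic_modP => a b; rewrite inE.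
Qed.

Lemma acyclic_count_cons_loop r u v E : r u = r v ->
  acyclic_count r ((u, v) :: E) = 0%N.
Proof.
move=> ruv; rewrite /acyclic_count /= count_cat !count_map.
by rewrite !(@eq_count _ _ pred0) ?count_pred0 // => A /=; rewrite acyclic_mod_loop.
Qed.

Lemma acyclic_count_cons r u v E : r u != r v ->
  acyclic_count r ((u, v) :: E) =
  (acyclic_count r E + acyclic_count (merge_fibers r u v) E)%N.
Proof.
move=> ruv; rewrite /acyclic_count /= count_cat !count_map.
have countE (P : pred {set T * T}) s : count P s = (\sum_(A <- s) P A)%N.
  by elim: s => [|A s /= ->]; rewrite ?big_nil ?big_cons.
rewrite !countE -!big_split /=; apply: eq_bigr => A _.
exact: acyclic_mod_deletion_contraction.
Qed.

End Acyclic.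

(** * Deletion and contraction for strict compositions *)

Local Open Scope ring_scope.

Section Counting.

Variable T : finType.
Implicit Types (r : T -> T) (E : seq (T * T)) (t : nat).

Definition idempotent_map r := forall i, r (r i) = r i.

Definition fiber_sizes r : seq nat :=
  [seq #|[pred i | r i == u]| | u <- enum [pred u | r u == u]].

Definition constant_on t r (x : {ffun T -> 'I_t.+1}) : bool :=
  [forall i, x (r i) == x i].

(** The generating function of the solutions, truncated at y <= M: the omitted
terms cannot contribute to the coefficient of X^t when t <= M. *)
Lemma coef_prod_denumerant lo (U : eqType) (w : U -> nat) (s : seq U) M t :
  all (fun u => 0 < w u)%N s -> (t <= M)%N ->
  (\prod_(u <- s) \sum_(y < M.+1 | (lo <= y)%N) 'X^(w u * y) : {poly nat})`_t
  = denumerant lo [seq w u | u <- s] t.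
Proof.
elim: s t => [|u s IHs] t; first by rewrite big_nil coef1; case: t.
rewrite [all _ _]/= => /andP[wu ws] tM.
rewrite big_cons big_distrl coef_sum [map _ _]/= (@denumerant_widen _ _ _ _ M.+1) //.
rewrite (@big_nat_widenl _ _ _ lo 0) // big_mkord big_mkcond [RHS]big_mkcond.
apply: eq_bigr => y _ /=.
case: (lo <= y)%N; rewrite ?andbF // andbT.
rewrite coefXnM ltnNge; case: leqP => //= le_wy.
by rewrite IHs // (leq_trans (leq_subr _ _)).
Qed.

(** A composition that is constant on the fibers of r is determined by its values
y_u at the representatives u, with total sum_u w_u y_u for fibers of size w_u.
Expanding the product of the generating functions enumerates these y, extended
by 0 outside the representatives. *)
Lemma card_constant_compositions lo t r : idempotent_map r ->
  #|[set x : {ffun T -> 'I_t.+1} |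
      [&& (\sum_i x i)%N == t, constant_on r x & [forall i, lo <= x i]%N]]|
  = denumerant lo (fiber_sizes r) t.
Proof.
move=> rr; pose U := [pred u | r u == u]; pose w u := #|[pred i | r i == u]|.
have w_gt0 : all (fun u => 0 < w u)%N (enum U).
  apply/allP => u; rewrite mem_enum => ru; apply/card_gt0P; exists u; exact: ru.
rewrite /fiber_sizes -(coef_prod_denumerant lo w_gt0 (leqnn t)) big_enum /=.
rewrite (big_distr_big_dep (ord0 : 'I_t.+1)) coef_sum -sum1_card.
under [RHS]eq_bigr => x _.
  have XE : \prod_(i in U) 'X^(w i * x i) = 'X^(\sum_(i in U) w i * x i)%N
      :> {poly nat}.
    by rewrite expr_sum.
  move: XE => /= ->; rewrite coefXn; over.
pose h (y : {ffun T -> 'I_t.+1}) := [ffun i => y (r i)].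
pose h' (x : {ffun T -> 'I_t.+1}) := [ffun u => if r u == u then x u else ord0].
rewrite (reindex_onto h h') => [|x].
  rewrite [RHS]big_mkcond [LHS]big_mkcond; apply: eq_bigr => y _.
  have -> : (h' (h y) == y) = [forall u, (r u != u) ==> (y u == ord0)].
    apply/eqP/forallP => [hy u | y0].
      by apply/implyP => ru; rewrite -hy ffunE (negPf ru).
    apply/ffunP => u; rewrite !ffunE; case: (eqVneq (r u) u) => [-> //| ru].
    by rewrite (eqP (implyP (y0 u) ru)).
  have sumE : (\sum_i h y i = \sum_(u in U) w u * y u)%N.
    rewrite (partition_big r U) /= => [|i _]; last by apply/eqP/rr.
    apply: eq_bigr => u _.
    rewrite (eq_bigr (fun=> nat_of_ord (y u))) => [|i /eqP ri].
      by rewrite sum_nat_const.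
    by rewrite ffunE ri.
  have hy_const : constant_on r (h y) by apply/forallP => i; rewrite !ffunE rr.
  rewrite inE sumE hy_const andTb.
  have -> : (y \in pfamily ord0 (mem U) (fun=> (fun j : 'I_t.+1 => lo <= j)%N)) =
     [forall i, lo <= h y i]%N && [forall u, (r u != u) ==> (y u == ord0)].
    apply/pfamilyP/andP => [[/supportP y0 y_lo] | [/forallP y_lo /forallP y0]].
      split; first by apply/forallP => i; rewrite ffunE; apply: y_lo; apply/eqP/rr.
      by apply/forallP => u; apply/implyP => ru; apply/eqP/y0; rewrite inE.
    split; first by apply/supportP => u ru; apply/eqP/(implyP (y0 u)).
    by move=> u /eqP ru; have := y_lo u; rewrite ffunE ru.
  by rewrite [t == _]eq_sym -andbA; case: eqP => // _; case: ifP.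
rewrite inE => /and3P[_ /forallP xr _].
by apply/ffunP => i; rewrite !ffunE rr eqxx (eqP (xr i)).
Qed.

(** The compositions counted for the graph with edge list E after contraction of
the fibers of r. *)
Definition strict_compositions_count E r t : nat :=
  #|[set x : {ffun T -> 'I_t.+1} |
      [&& (\sum_i x i)%N == t, constant_on r x & [forall i, 0 < x i]%N]
       && all (fun p => x p.1 != x p.2) E]|.

Definition monochromatic t (x : {ffun T -> 'I_t.+1}) E :=
  [seq p <- E | x p.1 == x p.2].

(** The other side of reciprocity for the contracted graph: the edges with equal
ends under x are those of the subgraphs induced by the level sets. *)
Definition weak_pairs_count E r t : nat :=
  (\sum_(x : {ffun T -> 'I_t.+1} | ((\sum_i x i)%N == t) && constant_on r x)
     acyclic_count r (monochromatic x E))%N.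

Lemma constant_on_merge t r u v (x : {ffun T -> 'I_t.+1}) :
  idempotent_map r -> r u != r v ->
  constant_on (merge_fibers r u v) x = constant_on r x && (x u == x v).
Proof.
move=> rr ruv; apply/forallP/andP => [xm | [/forallP xr /eqP xuv] i].
  have xu : x (r u) = x u by have := eqP (xm u); rewrite /merge_fibers (negPf ruv).
  have xv : x (r u) = x v by have := eqP (xm v); rewrite /merge_fibers eqxx.
  split; last by rewrite -xu xv.
  apply/forallP => i; have := xm i; have := xm (r v).
  rewrite /merge_fibers rr eqxx; case: (r i =P r v) => [-> | //].
  by move=> /eqP <-.
rewrite /merge_fibers; case: (r i =P r v) => [riv | _]; last exact: xr.
by rewrite (eqP (xr u)) xuv -(eqP (xr v)) -riv.
Qed.

Lemma idempotent_merge r u v : idempotent_map r -> idempotent_map (merge_fibers r u v).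
Proof.
move=> rr i; rewrite /merge_fibers; case: (r i =P r v) => [_ | /eqP riv].
  by rewrite rr if_same.
by rewrite rr (negPf riv).
Qed.

Lemma card_fixed_merge r u v : idempotent_map r -> r u != r v ->
  #|[pred i | r i == i]| = #|[pred i | merge_fibers r u v i == i]|.+1.
Proof.
move=> rr ruv; rewrite (cardD1 (r v)) inE rr eqxx add1n; congr _.+1.
apply: eq_card => i; rewrite !inE /merge_fibers.
case: (r i =P r v) => [riv | riv].
  rewrite riv eq_sym andNb; apply/esym/negbTE.
  by apply: contra ruv => /eqP rui; rewrite -riv -rui rr.
case: (r i =P i) => [ri | _]; last by rewrite andbF.
by rewrite andbT; apply/eqP => iv; apply: riv; rewrite iv rr.
Qed.

Lemma strict_count_loop r u v E t : r u = r v ->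
  strict_compositions_count ((u, v) :: E) r t = 0%N.
Proof.
move=> ruv; apply: eq_card0 => x; rewrite !inE /=.
apply/negP => /andP[/and3P[_ /forallP xr _] /andP[+ _]].
by rewrite -(eqP (xr u)) ruv (eqP (xr v)) eqxx.
Qed.

(** The compositions that are strict for the deletion have distinct or equal parts
at u and v. *)
Lemma strict_count_cons r u v E t : idempotent_map r -> r u != r v ->
  strict_compositions_count E r t =
  (strict_compositions_count ((u, v) :: E) r t
   + strict_compositions_count E (merge_fibers r u v) t)%N.
Proof.
move=> rr ruv; rewrite /strict_compositions_count.
rewrite -(cardsID [set x : {ffun T -> 'I_t.+1} | x u != x v]); congr (_ + _)%N.
  apply: eq_card => x; rewrite !inE /= -andbA.
  by congr (_ && _); rewrite andbC.
apply: eq_card => x; rewrite !inE /= negbK (constant_on_merge _ rr ruv).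
by do !bool_congr.
Qed.

Lemma weak_pairs_loop r u v E t : r u = r v ->
  weak_pairs_count ((u, v) :: E) r t = 0%N.
Proof.
move=> ruv; rewrite /weak_pairs_count big1 // => x /andP[_ /forallP xr].
have -> : monochromatic x ((u, v) :: E) = (u, v) :: monochromatic x E.
  by rewrite /monochromatic /= -(eqP (xr u)) ruv (eqP (xr v)) eqxx.
exact: acyclic_count_cons_loop.
Qed.

(** The edge uv is present in a level set only if x u = x v, that is, if x is
constant on the merged fibers; then deletion and contraction of acyclic
orientations gives the second term. *)
Lemma weak_pairs_cons r u v E t : idempotent_map r -> r u != r v ->
  weak_pairs_count ((u, v) :: E) r t =
  (weak_pairs_count E r t + weak_pairs_count E (merge_fibers r u v) t)%N.
Proof.
move=> rr ruv; rewrite /weak_pairs_count.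
under [X in (_ + X)%N]eq_bigl => x do rewrite (constant_on_merge _ rr ruv) andbA.
rewrite [X in (_ + X)%N]big_mkcondr /= -big_split /=; apply: eq_bigr => x _.
rewrite /monochromatic /=; case: (x u == x v); last by rewrite addn0.
exact: acyclic_count_cons.
Qed.

Section Reciprocity.

Variables (e : rel T) (L : nat).
Hypothesis e_sym : symmetric e.
Hypothesis L_gt0 : (0 < L)%N.
Hypothesis dvd_L : forall a, (0 < a <= max_component_order e)%N -> (a %| L)%N.

Let csym : connect_sym e := sym_connect_sym e_sym.

(** A fiber lies in the component of its representative. *)
Lemma fiber_size_dvd r u : (forall i, connect e i (r i)) -> r u = u ->
  (#|[pred i | r i == u]| %| L)%N.
Proof.
move=> re ru; apply: dvd_L; apply/andP; split.
  by apply/card_gt0P; exists u; rewrite inE ru.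
pose C := [set y in [set: T] | connect e u y].
have CC : C \in components e by apply: imset_f; rewrite inE.
apply: (@leq_trans #|C|); last exact: (@leq_bigmax_cond _ _ (fun C : {set T} => #|C|)).
apply: subset_leq_card; apply/subsetP => i /eqP ri.
by rewrite !inE -ri csym /= re.
Qed.

(** Induction on the list of edges: the function for (u, v) :: E is the difference
of those for the deletion and for the contraction, or 0 if u and v are already
contracted to one node. *)
Lemma strict_count_reciprocity E r : (0 < #|T|)%N -> idempotent_map r ->
    (forall i, connect e i (r i)) -> all (fun p => e p.1 p.2) E ->
  exists f : int -> rat, [/\ quasipoly L f,
    forall t : nat, (0 < t)%N -> f t%:Z = (strict_compositions_count E r t)%:R &
    forall t : nat, f (- t%:Z) =
      (-1) ^+ (#|[pred i | r i == i]|).-1 * (weak_pairs_count E r t)%:R].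
Proof.
move=> T0; have fixed_gt0 r' : idempotent_map r' -> (0 < #|[pred i | r' i == i]|)%N.
  move=> rr'; case/card_gt0P: T0 => i _.
  by apply/card_gt0P; exists (r' i); rewrite inE rr'.
elim: E r => [|[u v] E IHE] r rr re; last first.
  rewrite [all _ _]/= => /andP[uv eE].
  have [ruv | ruv] := eqVneq (r u) (r v).
    exists (fun=> 0); split=> [| t _ | t].
    - exact: quasipoly_periodic.
    - by rewrite strict_count_loop.
    by rewrite weak_pairs_loop // mulr0.
  have [f [f_qp fp fn]] := IHE r rr re eE.
  have me : forall i, connect e i (merge_fibers r u v i).
    move=> i; rewrite /merge_fibers; case: (r i =P r v) => [riv | _]; last exact: re.
    apply: connect_trans (re i) _; rewrite riv csym.
    apply: connect_trans _ (re v); rewrite csym; apply: connect_trans _ (re u).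
    by rewrite csym connect1.
  have [g [g_qp gp gn]] := IHE _ (idempotent_merge u v rr) me eE.
  exists (fun s => f s + (-1) * g s); split=> [| t t0 | t].
  - exact/quasipolyD/quasipolyZ.
  - by rewrite fp // gp // (strict_count_cons _ _ rr ruv) natrD mulN1r addrK.
  rewrite fn gn weak_pairs_cons // natrD mulrDr; congr (_ + _).
  rewrite (card_fixed_merge rr ruv) /=.
  rewrite -[in RHS](prednK (fixed_gt0 _ (idempotent_merge u v rr))) exprS.
  by rewrite mulrA.
move=> _; exists (denumerant_ext (fiber_sizes r)).
have sz : size (fiber_sizes r) = #|[pred i | r i == i]| by rewrite size_map -cardE.
split=> [| t t0 | t].
- apply: denumerant_ext_quasipoly => //; first by rewrite sz fixed_gt0.
  apply/allP => a /mapP[u]; rewrite mem_enum => /eqP ru ->.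
  rewrite fiber_size_dvd // andbT; apply/card_gt0P; exists u; apply/eqP/ru.
- rewrite denumerant_ext_pos // -card_constant_compositions //; congr _%:R.
  by apply: eq_card => x; rewrite !inE andbT.
rewrite denumerant_ext_npos sz -card_constant_compositions // -sum1_card.
congr (_ * _%:R).
rewrite /weak_pairs_count; apply: eq_big => [x | x _].
  by rewrite inE andbA (_ : [forall i, _] = true) ?andbT //; apply/forallP.
by rewrite acyclic_count_nil.
Qed.

End Reciprocity.

End Counting.

(** * Orientations as lists of sets of arcs *)

Section OrientationLists.

Variable T : finType.
Implicit Types (E : seq (T * T)) (A : {set T * T}) (p q : T * T).

Definition rev_arc p := (p.2, p.1).

Lemma rev_arcK : involutive rev_arc.
Proof. by case. Qed.

Definition orients E A : bool :=
  [forall p in A, (p \in E) || (rev_arc p \in E)] &&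
  all (fun p => (p \in A) (+) (rev_arc p \in A)) E.

Definition reversal_free E := forall p, p \in E -> rev_arc p \notin E.

Lemma orients_notin E A p : orients E A ->
  p \notin E -> rev_arc p \notin E -> p \notin A.
Proof.
case/andP=> /forall_inP AE _ pE qE; apply/negP => /AE.
by rewrite (negPf pE) (negPf qE).
Qed.

(** Removing the chosen direction q of the edge p; treating both choices of q at
once serves the two halves of the list [orientations (p :: E)]. *)
Lemma orients_cons E A p q : p \notin E -> rev_arc p \notin E ->
    p != rev_arc p -> q \in [:: p; rev_arc p] ->
  q \in A -> rev_arc q \notin A -> orients (p :: E) A = orients E (A :\ q).
Proof.
move=> pE rpE prp q_p qA rqA.
have qE : q \notin E by move: q_p; rewrite !inE => /orP[] /eqP->.
have rqE : rev_arc q \notin E.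
  by move: q_p; rewrite !inE => /orP[] /eqP->; rewrite ?rev_arcK.
have xq : (p \in A) (+) (rev_arc p \in A).
  by move: q_p qA rqA; rewrite !inE => /orP[] /eqP->; rewrite ?rev_arcK => -> /negPf->.
rewrite /orients /= xq; congr (_ && _).
  apply/forall_inP/forall_inP => AE s.
    rewrite in_setD1 => /andP[sq sA]; have := AE s sA; rewrite !inE.
    have sp : (s == p) = false.
      move: q_p sq rqA; rewrite !inE => /orP[] /eqP-> /negPf // _.
      by rewrite rev_arcK => pA; apply: contraNF pA => /eqP <-.
    have rsp : (rev_arc s == p) = false.
      rewrite (can2_eq rev_arcK rev_arcK).
      move: q_p sq rqA; rewrite !inE => /orP[] /eqP-> /negPf // _ pA.
      by apply: contraNF pA => /eqP <-.
    by rewrite sp rsp.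
  move=> sA; have [-> | sq] := eqVneq s q.
    by move: q_p; rewrite !inE => /orP[] /eqP->; rewrite ?rev_arcK eqxx ?orbT.
  have : s \in A :\ q by rewrite in_setD1 sq.
  by move/AE; rewrite !inE => /orP[] ->; rewrite !orbT.
apply: eq_in_all => s sE; rewrite !in_setD1.
have -> : s != q by apply: contraNneq qE => <-.
by have -> : rev_arc s != q by apply: contraNneq rqE => <-; rewrite rev_arcK.
Qed.

Lemma orientationsP E : uniq E -> reversal_free E ->
  uniq (orientations E) /\ (forall A, (A \in orientations E) = orients E A).
Proof.
elim: E => [_ _ | p E IHE].
  split=> // A; rewrite inE /orients /= andbT.
  apply/eqP/forall_inP => [-> s | A0]; first by rewrite inE.
  by apply/setP => s; rewrite inE; apply/negP => /A0.
rewrite [uniq _]/= => /andP[pE uE] free.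
have freeE : reversal_free E.
  move=> s sE; have : s \in p :: E by rewrite inE sE orbT.
  by move/free; rewrite inE => /norP[].
have [rpE prp] : rev_arc p \notin E /\ p != rev_arc p.
  have /free : p \in p :: E by rewrite inE eqxx.
  by rewrite inE eq_sym => /norP[].
have [uO memO] := IHE uE freeE.
have notA q A : q \in [:: p; rev_arc p] -> A \in orientations E -> q \notin A.
  rewrite memO => q_p AO; apply: (orients_notin AO); move: q_p;
  by rewrite !inE => /orP[] /eqP->; rewrite ?rev_arcK.
have inj q : q \in [:: p; rev_arc p] ->
  {in orientations E &, injective (fun A => q |: A)}.
  move=> qp A B /(notA _ _ qp) qA /(notA _ _ qp) qB.
  by move/(congr1 (fun S => S :\ q)); rewrite !setU1K.
have pp : p \in [:: p; rev_arc p] by rewrite !inE eqxx.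
have rp : rev_arc p \in [:: p; rev_arc p] by rewrite !inE eqxx orbT.
split.
  rewrite /= cat_uniq !map_inj_in_uniq ?uO ?andbT /=; [ | exact: inj | exact: inj].
  apply/hasPn => _ /mapP[A AO ->]; apply/mapP => -[B BO /setP/(_ p)].
  by rewrite !inE eqxx (negPf prp) (negPf (notA _ _ pp AO)).
move=> A; rewrite [orientations _]/= mem_cat; apply/orP/idP => [AO | AO].
  have [q [B [qp BO AE]]] : exists q B,
      [/\ q \in [:: p; rev_arc p], B \in orientations E & A = q |: B].
    by case: AO => /mapP[B BO ->]; [exists p, B | exists (rev_arc p), B].
  have qB := notA _ _ qp BO.
  have rqp : rev_arc q \in [:: p; rev_arc p].
    by move: qp; rewrite !inE => /orP[] /eqP->; rewrite ?rev_arcK eqxx ?orbT.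
  have rqq : rev_arc q != q.
    by move: qp; rewrite !inE => /orP[] /eqP->; rewrite ?rev_arcK // eq_sym.
  rewrite (@orients_cons _ _ p q) //.
  - by rewrite AE setU1K // -memO.
  - by rewrite AE setU11.
  by rewrite AE !inE negb_or rqq (notA _ _ rqp BO).
have : (p \in A) (+) (rev_arc p \in A) by case/andP: AO => _ /= /andP[].
have [pA /= rpA | pA /= rpA] := boolP (p \in A); [left | right];
  apply/mapP; [exists (A :\ p) | exists (A :\ rev_arc p)]; rewrite ?setD1K // memO.
  by rewrite -(@orients_cons E A p p).
by rewrite -(@orients_cons E A p (rev_arc p)) // rev_arcK.
Qed.

End OrientationLists.

(** * Graphs and level sets *)

Section OrdinalGraphs.

Variable n : nat.
Implicit Types (e : rel 'I_n).

(** The order on the nodes selects one direction of each edge. *)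
Definition edges e : seq ('I_n * 'I_n) :=
  [seq p : 'I_n * 'I_n <- enum {: 'I_n * 'I_n} | (p.1 < p.2)%N && e p.1 p.2].

Lemma mem_edges e i j : ((i, j) \in edges e) = (i < j)%N && e i j.
Proof. by rewrite mem_filter mem_enum andbT. Qed.

Lemma is_orientation_edges e A : symmetric e -> irreflexive e ->
  is_orientation e A = orients (edges e) A.
Proof.
move=> e_sym e_irr.
have edgesE i j : ((i, j) \in edges e) || ((j, i) \in edges e) = e i j.
  rewrite !mem_edges (e_sym j i) -andb_orl; case: ltngtP => //= /val_inj ->.
  by rewrite e_irr.
apply/forallP/andP => [oA | [/forall_inP AE /allP xA] i].
  split; first apply/forall_inP => -[i j] ijA.
    rewrite edgesE; apply/idPn => nij.
    by have /forallP/(_ j) := oA i; rewrite (negPf nij) ijA.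
  apply/allP => -[i j]; rewrite mem_edges => /andP[_ ij].
  by have /forallP/(_ j) := oA i; rewrite ij.
apply/forallP => j; case: ifP => [ij | /negbT nij].
  have := ij; rewrite -edgesE => /orP[] /xA //=.
  by rewrite addbC.
by apply: contra nij => /AE; rewrite edgesE.
Qed.

Lemma is_orientation_irr e A : irreflexive e -> is_orientation e A ->
  irreflexive (Defs.arc A).
Proof.
move=> e_irr /forallP oA i; have /forallP/(_ i) := oA i.
by rewrite e_irr => /negPf.
Qed.

Lemma card_acyclic_orientations e : symmetric e -> irreflexive e ->
  #|acyclic_orientations e| = acyclic_count id (edges e).
Proof.
move=> e_sym e_irr.
have uE : uniq (edges e) by rewrite filter_uniq ?enum_uniq.
have rE : reversal_free (edges e).
  by case=> i j; rewrite !mem_edges => /andP[ij _]; rewrite ltnNge ltnW.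
have [uO memO] := orientationsP uE rE.
rewrite /acyclic_count -size_filter -(card_uniqP (filter_uniq _ uO)).
apply: eq_card => A; rewrite inE mem_filter memO.
rewrite -is_orientation_edges // andbC; have [oA | _] := boolP (is_orientation e A).
  by rewrite !andbT acyclic_mod_id //; apply: is_orientation_irr oA.
by rewrite !andbF.
Qed.

Lemma strict_countE e t : symmetric e -> irreflexive e ->
  strict_count e t = strict_compositions_count (edges e) id t.
Proof.
move=> e_sym e_irr; apply: eq_card => x; rewrite !inE.
have -> : constant_on id x by apply/forallP => i; apply: eqxx.
rewrite /=; congr (_ && _).
apply/forallP/allP => [sx [i j] | sx i].
  rewrite mem_edges => /andP[_ ij].
  by have /forallP/(_ j)/implyP/(_ ij) := sx i.
apply/forallP => j; apply/implyP => ij.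
case: (ltngtP i j) => [lt_ij | lt_ji | /val_inj E].
- by apply: (sx (i, j)); rewrite mem_edges lt_ij.
- by rewrite eq_sym; apply: (sx (j, i)); rewrite mem_edges lt_ji e_sym.
by move: ij; rewrite E e_irr.
Qed.

Definition monochromatic_edges t e (x : {ffun 'I_n -> 'I_t.+1}) : rel 'I_n :=
  [rel i j | e i j && (x i == x j)].

Lemma monochromatic_edgesE t e (x : {ffun 'I_n -> 'I_t.+1}) :
  monochromatic x (edges e) = edges (monochromatic_edges e x).
Proof.
rewrite /monochromatic -filter_predI; apply: eq_filter => -[i j] /=.
by rewrite [LHS]andbC -andbA.
Qed.

Lemma acyclic_sub (A B : {set 'I_n * 'I_n}) : A \subset B -> acyclic B -> acyclic A.
Proof.
move=> /subsetP AB /acyclicP acB; apply/acyclicP => c /andP[cA uc].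
by apply: acB; rewrite /ucycle uc andbT; apply: sub_cycle cA => i j; apply: AB.
Qed.

(** An arc belongs to the level set of the common value of its ends, so a family
of orientations of the level sets is the same as one orientation of all edges
with equal ends; a closed walk along these stays in one level set. *)
Lemma card_level_orientations t e (x : {ffun 'I_n -> 'I_t.+1}) :
  symmetric e -> irreflexive e ->
  #|[set F : {ffun 'I_t.+1 -> {set 'I_n * 'I_n}} |
     [forall k, F k \in acyclic_orientations (induced e (level x k))]]|
  = #|acyclic_orientations (monochromatic_edges e x)|.
Proof.
move=> e_sym e_irr; set ex := monochromatic_edges e x.
(* G splits an orientation into its restrictions to the level sets. *)
pose G (A : {set 'I_n * 'I_n}) : {ffun 'I_t.+1 -> {set 'I_n * 'I_n}} :=
  [ffun k => [set p in A | (x p.1 == k) && (x p.2 == k)]].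
have ex_irr : irreflexive ex by move=> i; rewrite /ex /monochromatic_edges /= e_irr.
have orA A i j : is_orientation ex A -> (i, j) \in A -> x i = x j.
  move=> /forallP/(_ i)/forallP/(_ j); rewrite /ex /monochromatic_edges /=.
  by case: (x i =P x j) => //; rewrite andbF => _ /negPf->.
rewrite -(@card_in_imset _ _ G) => [|A B]; last first.
  rewrite !inE => /andP[oA _] /andP[oB _] /ffunP GAB.
  apply/setP => -[i j]; have /setP/(_ (i, j)) := GAB (x i).
  rewrite !ffunE !inE /= eqxx /=.
  have [xij | xij] := eqVneq (x j) (x i); first by rewrite !andbT.
  move=> _; apply/idP/idP => ijA; case/eqP: xij; apply/esym;
    [exact: orA oA ijA | exact: orA oB ijA].
apply: eq_card => F; rewrite inE; apply/forallP/imsetP => [acF | [A]]; last first.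
  rewrite inE => /andP[oA acA] -> k; rewrite inE ffunE; apply/andP; split; last first.
    by apply: acyclic_sub acA; apply/subsetP => p; rewrite inE => /andP[].
  apply/forallP => i; apply/forallP => j.
  have /forallP/(_ i)/forallP/(_ j) := oA.
  rewrite /ex /monochromatic_edges /induced /= !inE /=.
  have [xi | xi] := eqVneq (x i) k; have [xj | xj] := eqVneq (x j) k;
    rewrite ?andbF ?andbT //=.
  by rewrite xi xj eqxx !andbT.
have irrF k : irreflexive (induced e (level x k)).
  by move=> i; rewrite /induced /= e_irr !andbF.
have oF k : is_orientation (induced e (level x k)) (F k).
  by have := acF k; rewrite inE => /andP[].
have levF k i j : (i, j) \in F k -> x i = k /\ x j = k.
  move=> ijF; have /forallP/(_ i)/forallP/(_ j) := oF k; rewrite ijF /induced /= !inE.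
  by case: (x i =P k); case: (x j =P k).
pose A := [set p | p \in F (x p.1)].
have oA : is_orientation ex A.
  apply/forallP => i; apply/forallP => j; rewrite /ex /monochromatic_edges !inE /=.
  have /forallP/(_ i)/forallP/(_ j) := oF (x i); rewrite /induced /= !inE eqxx /=.
  case: (x j =P x i) => [-> | /eqP xji]; first by rewrite eqxx andbT.
  by rewrite eq_sym (negPf xji) andbF.
exists A; last first.
  apply/ffunP => k; apply/setP => -[i j]; rewrite ffunE !inE /=.
  apply/idP/andP => [ijF | [ijF /andP[/eqP <- _]] //].
  by have [-> ->] := levF _ _ _ ijF; rewrite eqxx.
rewrite inE oA -acyclic_mod_id; last exact: is_orientation_irr oA.
apply/acyclic_modP => a b; rewrite inE /= => abF.
have acFa : acyclic_mod id (F (x a)).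
  rewrite acyclic_mod_id; last exact: is_orientation_irr (oF _).
  by have := acF (x a); rewrite inE => /andP[].
have [_ xb] := levF _ _ _ abF.
apply: contra (acyclic_modP _ _ acFa a b abF) => /connectP[p].
elim: p b xb {abF} => [|c p IHp] b xb /=; first by move=> _ ->; apply: connect0.
case/andP=> /orP[| /eqP <-]; last exact: IHp.
rewrite inE /= xb => bcF cp aE.
have [_ xc] := levF _ _ _ bcF.
by apply: connect_trans (IHp _ xc cp aE); apply: connect1; apply/orP; left.
Qed.

Lemma card_composition_orientation_pairs e t : symmetric e -> irreflexive e ->
  #|composition_orientation_pairs e t| = weak_pairs_count (edges e) id t.
Proof.
move=> e_sym e_irr; rewrite -sum1_card /weak_pairs_count.
have pairE (p : {ffun 'I_n -> 'I_t.+1} * {ffun 'I_t.+1 -> {set 'I_n * 'I_n}}) :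
    (p \in composition_orientation_pairs e t) = (p.1 \in weak_compositions n t) &&
      [forall k, p.2 k \in acyclic_orientations (induced e (level p.1 k))].
  by rewrite inE.
rewrite (eq_bigl _ _ pairE) -(pair_big_dep (fun x => x \in weak_compositions n t)
  (fun x (F : {ffun 'I_t.+1 -> {set 'I_n * 'I_n}}) =>
     [forall k, F k \in acyclic_orientations (induced e (level x k))])
  (fun _ _ => 1%N)) /=.
apply: eq_big => [x | x _].
  rewrite inE (_ : constant_on _ _) ?andbT //.
  by apply/forallP => i; apply: eqxx.
rewrite monochromatic_edgesE -card_acyclic_orientations.
- rewrite -card_level_orientations // -sum1_card; apply: eq_bigl => F.
  by rewrite inE.
- by move=> i j; rewrite /monochromatic_edges /= e_sym eq_sym.
by move=> i; rewrite /monochromatic_edges /= e_irr.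
Qed.

(** The only weak composition of 0 has a single level set, the whole graph. *)
Lemma composition_orientation_pairs0 e : symmetric e -> irreflexive e ->
  #|composition_orientation_pairs e 0| = #|acyclic_orientations e|.
Proof.
move=> e_sym e_irr; rewrite card_composition_orientation_pairs //.
rewrite card_acyclic_orientations // /weak_pairs_count.
rewrite (big_pred1 [ffun=> ord0]) => [|x].
  congr acyclic_count; apply/all_filterP/allP => p _; by rewrite !ffunE.
have -> : x = [ffun=> ord0] by apply/ffunP => i; rewrite ffunE ord1.
rewrite big1 => [|i _]; last by rewrite ffunE.
by rewrite inE !eqxx; apply/forallP => i; apply: eqxx.
Qed.

End OrdinalGraphs.

(** * The least common multiple and the theorem *)

Lemma dvdn_lambda a m : (0 < a <= m)%N -> (a %| lambda m)%N.
Proof.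
case/andP=> a0 am; rewrite /lambda.
by rewrite (big_rem a) /= ?dvdn_lcml // mem_index_iota a0 ltnS am.
Qed.

Lemma lambda_gt0 m : (0 < lambda m)%N.
Proof.
rewrite /lambda; elim: m => [|m IHm]; first by rewrite big_nil.
by rewrite big_nat_recr // lcmn_gt0 IHm.
Qed.

Theorem theorem6p1 (n : nat) (e : rel 'I_n) (n_gt0 : (0 < n)%N)
    (e_sym : symmetric e) (e_irr : irreflexive e) :
  (exists f : int -> rat, quasipolynomial_extension (strict_count e) f) /\
  (forall f : int -> rat, quasipolynomial_extension (strict_count e) f ->
     [/\ exists2 p : nat, is_least_period p f
           & (p %| lambda (max_component_order e))%N,
         (-1) ^+ n.-1 * f 0 = #|acyclic_orientations e|%:R
       & forall t : nat, (-1) ^+ n.-1 * f (- t%:Z)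
           = #|composition_orientation_pairs e t|%:R]).
Proof.
set L := lambda _; have L0 : (0 < L)%N := lambda_gt0 _.
have edges_e : all (fun p => e p.1 p.2) (edges e).
  by apply/allP => -[i j]; rewrite mem_edges => /andP[].
have T0 : (0 < #|'I_n|)%N by rewrite card_ord.
have [g [g_qp gp gn]] := strict_count_reciprocity e_sym L0 (@dvdn_lambda^~ _) T0
  (fun i => erefl (id i)) (fun i => connect0 e i) edges_e.
split; first exists g.
  split=> [|t t0]; first by exists L => //; apply/has_periodP.
  by rewrite gp // strict_countE.
move=> f [[p p0 /(has_periodP _ p0) f_qp] fp].
have fE : forall t, f t = g t.
  apply: quasipoly_uniq f_qp g_qp _ => // t t0.
  by rewrite fp // gp // strict_countE.
have fn (t : nat) : (-1) ^+ n.-1 * f (- t%:Z) = #|composition_orientation_pairs e t|%:R.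
  rewrite fE gn (_ : #|_| = n).
    by rewrite mulrA -expr2 sqrr_sign mul1r card_composition_orientation_pairs.
  by rewrite -[RHS]card_ord; apply: eq_card => i; rewrite !inE eqxx.
split=> //.
  by apply: least_period_dvd => //; apply: quasipoly_ext g_qp => t; rewrite fE.
by rewrite -composition_orientation_pairs0 // -fn oppr0.
Qed.
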